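(* Consider a fixed instance of (SOCKP). An optimal solution to (RKPm) with $\Delta=m^2$ is also an optimal solution to (SOCKP) if the value of $m$ is sufficiently large; that is, there is a positive integer $m_0$ (depending on the instance) such that for every integer $m\ge m_0$, every optimal solution to (RKPm) with $\Delta=m^2$ is an optimal solution to (SOCKP).
   Context: $N=\{1,\dots,n\}$ is a set of items; item $j$ has nonnegative integer profit $p_j$, mean weight $\hat a_j\ge0$ and standard deviation $\sigma_j\ge 0$; $b$ is a nonnegative integer capacity and $\Omega>0$ a parameter. (SOCKP): maximize $\sum_{j\in N}p_jx_j$ subject to $\sum_{j\in N}\hat a_jx_j+\Omega\sqrt{\sum_{j\in N}\sigma_j^2x_j^2}\le b$, $x\in\{0,1\}^n$. (RKPm), for a positive integer $m$, $M=\{1,\dots,m\}$, and a parameter $\Delta$: maximize $\sum_{j\in N}p_jx_j$ subject to $\sum_{j\in N}\hat a_jx_j+\beta^m(x,\Delta)\le b$, $x\in\{0,1\}^n$, where, with $d_j^k=\Omega\sigma_j/m$ and $f_j^k=2k-1$, $$\beta^m(x,\Delta)=\max\Big\{\sum_{j\in N}\sum_{k\in M}d_j^kx_jz_j^k \;\Big|\; \sum_{j\in N}\sum_{k\in M}f_j^kz_j^k\le\Delta,\ 0\le z_j^k\le 1\ \forall j\in N,k\in M\Big\}.$$ *)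

(* Defs.v *)
From mathcomp Require Import all_boot all_order all_algebra.
From mathcomp Require Import all_classical all_reals all_analysis.

Set Implicit Arguments.
Unset Strict Implicit.
Unset Printing Implicit Defensive.
Import Order.TTheory GRing.Theory Num.Theory numFieldNormedType.Exports.

Local Open Scope classical_set_scope.
Local Open Scope ring_scope.

(* Items are the elements j of 'I_n.  A 0/1 vector x is a finite function into
   bool, which coerces to nat; its real coordinates are (x j)%:R. *)
Definition profit (n : nat) (p : 'I_n -> nat) (x : {ffun 'I_n -> bool}) : nat :=
  (\sum_(j < n) p j * x j)%N.

Definition sockp_feasible (R : realType) (n : nat) (ahat sigma : 'I_n -> R)
    (b : nat) (Omega : R) (x : {ffun 'I_n -> bool}) : Prop :=
  \sum_(j < n) ahat j * (x j)%:R
    + Omega * Num.sqrt (\sum_(j < n) sigma j ^+ 2 * (x j)%:R ^+ 2) <= b%:R.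

Definition rkp_d (R : realType) (n : nat) (sigma : 'I_n -> R) (Omega : R)
    (m : nat) (j : 'I_n) (k : 'I_m) : R :=
  Omega * sigma j / m%:R.

(* k ranges over 'I_m, i.e. from 0 to m - 1, so the 1-based index is k.+1. *)
Definition rkp_f (R : realType) (n m : nat) (j : 'I_n) (k : 'I_m) : R :=
  2 * k.+1%:R - 1.

Definition beta_feasible (R : realType) (n m : nat) (Delta : R)
    (z : 'M[R]_(n, m)) : Prop :=
  \sum_(j < n) \sum_(k < m) rkp_f R j k * z j k <= Delta /\
  (forall j k, 0 <= z j k <= 1).

Definition beta_objective (R : realType) (n : nat) (sigma : 'I_n -> R)
    (Omega : R) (m : nat) (x : {ffun 'I_n -> bool}) (z : 'M[R]_(n, m)) : R :=
  \sum_(j < n) \sum_(k < m) rkp_d sigma Omega j k * (x j)%:R * z j k.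

(* The supremum is attained as soon as 0 <= Delta, see beta_max below. *)
Definition beta (R : realType) (n : nat) (sigma : 'I_n -> R) (Omega : R)
    (m : nat) (x : {ffun 'I_n -> bool}) (Delta : R) : R :=
  sup [set beta_objective sigma Omega x z
      | z in [set z : 'M[R]_(n, m) | beta_feasible Delta z]].

Definition rkp_feasible (R : realType) (n : nat) (ahat sigma : 'I_n -> R)
    (b : nat) (Omega : R) (m : nat) (Delta : R)
    (x : {ffun 'I_n -> bool}) : Prop :=
  \sum_(j < n) ahat j * (x j)%:R + beta sigma Omega m x Delta <= b%:R.

Definition optimal_solution (n : nat) (p : 'I_n -> nat)
    (feasible : {ffun 'I_n -> bool} -> Prop) (x : {ffun 'I_n -> bool}) : Prop :=
  feasible x /\ forall y, feasible y -> (profit p y <= profit p x)%N.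

Lemma continuous_mull (R : realType) (T : topologicalType) (a : R) (g : T -> R) :
  continuous g -> continuous (fun t => a * g t).
Proof. by move=> h t; apply: cvgM; [exact: cvg_cst|exact: h]. Qed.

Lemma continuous_coord (R : realType) (I : eqType) (i : I) :
  continuous (fun f : prod_topology (fun _ : I => R) => f i : R).
Proof. have := @proj_continuous I (fun _ : I => R) i; exact. Qed.

Lemma continuous_lin (R : realType) (I : finType) (c : I -> R) :
  continuous (fun f : prod_topology (fun _ : I => R) => \sum_i c i * f i : R).
Proof.
have cc i := @continuous_mull R _ (c i) _ (@continuous_coord R I i).
have := @continuous_big R I +%R 0 xpredT (@add_continuous R) _ (index_enum I)
  _ (fun i _ => cc i).
exact.
Qed.

Lemma box_lp_max (R : realType) (I : finType) (c d : I -> R) (Delta : R)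
    (P := fun f : I -> R =>
      \sum_i c i * f i <= Delta /\ forall i, 0 <= f i <= 1) :
  0 <= Delta ->
  exists2 f, P f & forall g, P g -> \sum_i d i * g i <= \sum_i d i * f i.
Proof.
move=> Delta_ge0; pose V := prod_topology (fun _ : I => R).
pose A := [set f : V | P f].
have A0 : A !=set0.
  exists (fun=> 0); split=> [|i]; last by rewrite lexx ler01.
  by rewrite big1// => i _; rewrite mulr0.
have cA : compact A.
  pose B := [set f : V | forall i, `[(0 : R), 1]%classic (f i)].
  have -> : A = B `&` (fun f : V => \sum_i c i * f i) @^-1` [set t | t <= Delta].
    apply/seteqP; split=> f [h1 h2].
      by split=> // i; rewrite /= in_itv; exact: h2.
    by split=> // i; have := h1 i; rewrite /= in_itv.
  apply: compact_closedI.
    exact: (@tychonoff I (fun=> R) (fun=> `[(0 : R), 1]%classic)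
      (fun=> @segment_compact _ _ _)).
  have /continuous_closedP := @continuous_lin R I c.
  by apply; exact: closed_le.
have [f fA fmax] :=
  compact_EVT_max A0 cA (continuous_subspaceT (@continuous_lin R I d)).
by exists f; [exact: set_mem fA|move=> g Pg; apply: fmax; exact: mem_set].
Qed.

Lemma beta_max (R : realType) (n m : nat) (sigma : 'I_n -> R) (Omega Delta : R)
    (x : {ffun 'I_n -> bool}) :
  0 <= Delta ->
  exists2 z : 'M[R]_(n, m), beta_feasible Delta z &
    beta sigma Omega m x Delta = beta_objective sigma Omega x z /\
    forall z' : 'M[R]_(n, m), beta_feasible Delta z' ->
      beta_objective sigma Omega x z' <= beta_objective sigma Omega x z.
Proof.
move=> Delta_ge0.
pose c (i : 'I_n * 'I_m) := rkp_f R i.1 i.2.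
pose d (i : 'I_n * 'I_m) := rkp_d sigma Omega i.1 i.2 * (x i.1)%:R.
have [f [fD f01] fmax] := box_lp_max c d Delta_ge0.
pose z : 'M[R]_(n, m) := \matrix_(j, k) f (j, k).
have zf i : z i.1 i.2 = f i by case: i => j k; rewrite mxE.
have zF : beta_feasible Delta z.
  split=> [|j k]; last by rewrite mxE.
  rewrite pair_bigA /=; under eq_bigr do rewrite zf.
  exact: fD.
have zE : beta_objective sigma Omega x z = \sum_i d i * f i.
  by rewrite /beta_objective pair_bigA /=; under eq_bigr do rewrite zf.
have zmax (z' : 'M[R]_(n, m)) : beta_feasible Delta z' ->
    beta_objective sigma Omega x z' <= beta_objective sigma Omega x z.
  move=> [z'D z'01]; rewrite zE /beta_objective pair_bigA /=.
  apply: (fmax (fun i => z' i.1 i.2)); split=> [|i]; last exact: z'01.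
  by rewrite pair_bigA in z'D.
exists z => //; split=> //.
apply/eqP; rewrite eq_le; apply/andP; split.
  apply: ge_sup; first by exists (beta_objective sigma Omega x z), z.
  by move=> _ [z' /zmax + <-].
apply: ub_le_sup; last by exists z.
by exists (beta_objective sigma Omega x z) => _ [z' /zmax + <-].
Qed.

(* Main.v *)
Require Import Defs.
From mathcomp Require Import all_boot all_order all_algebra.
From mathcomp Require Import all_classical all_reals all_analysis.
From mathcomp Require Import ring lra.
Import Order.TTheory GRing.Theory Num.Theory.
Local Open Scope ring_scope.

(** The feasible sets of the two problems coincide for large [m], so they have
    the same optimal solutions.

    Put [w j = (\sum_k z j k) / m] for a point [z] of the linear program that
    defines [beta]. The objective depends on [z] only through [w]: it is
    [Omega * \sum_j sigma j * x j * w j]. The costs 1, 3, 5, ... are the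
    increments of the squares, so filling the cells of item [j] from the first
    one on costs [(m * w j) ^ 2] when [m * w j] is an integer, and every other
    way to reach [w j] costs at least as much ([sqr_sum_le_weighted]). With the
    budget [m ^ 2], the program is therefore a discretization, from inside, of
    the maximization of a linear form over the Euclidean unit ball, whose value
    is the norm [Omega * sqrt (\sum_j sigma j ^ 2 * x j ^ 2)].

    Hence [beta] never exceeds the norm ([beta_le_norm]). Rounding the maximizer
    over the ball down to multiples of [1 / m] loses at most [1 / m] in each
    coordinate, so [beta] falls short of the norm by at most
    [Omega * (\sum_j sigma j) / m] ([norm_le_beta]). There are finitely many
    0/1 vectors, so some [m0] makes this error smaller than the excess over the
    capacity of each vector that violates the constraint of (SOCKP); from [m0]
    on such a vector violates the constraint of (RKPm) too. *)

(** Adding [z_m] to a partial sum [S <= m] raises the square by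
    [2 * S * z_m + z_m ^ 2 <= (2 * m + 1) * z_m]. *)
Lemma sqr_sum_le_weighted {R : realDomainType} {m : nat} (z : 'I_m -> R) :
  (forall k, 0 <= z k <= 1) ->
  (\sum_(k < m) z k) ^+ 2 <= \sum_(k < m) (2 * k.+1%:R - 1) * z k.
Proof.
elim: m z => [|m IHm] z z01; first by rewrite !big_ord0 expr0n.
have z01' k : 0 <= z (widen_ord (leqnSn m) k) <= 1 by exact: z01.
have S_le : \sum_(k < m) z (widen_ord (leqnSn m) k) <= m%:R.
  rewrite -[leRHS]mulr1n -[m in leRHS]card_ord -sumr_const.
  by apply: ler_sum => k _; have /andP[] := z01' k.
have {IHm} := IHm _ z01'.
rewrite !big_ord_recr /=.
set S := \sum_(k < m) _ in S_le *; set T := \sum_(k < m) _.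
have /andP[z0 z1] := z01 ord_max.
rewrite -[m.+1]addn1 natrD.
nra.
Qed.

Lemma sum_odd (R : comNzRingType) (n : nat) :
  \sum_(k < n) (2 * k.+1%:R - 1) = n%:R ^+ 2 :> R.
Proof.
elim: n => [|n IHn]; first by rewrite big_ord0 expr0n.
rewrite big_ord_recr /= IHn -[n.+1]addn1 natrD.
by ring.
Qed.

Lemma sum_ord_prefix (V : pzSemiRingType) (m t : nat) (F : nat -> V) :
  (t <= m)%N -> \sum_(k < m) F k * (k < t)%:R = \sum_(k < t) F k.
Proof.
move=> tm; rewrite (big_ord_widen _ _ tm) [RHS]big_mkcond /=.
by apply: eq_bigr => k _; case: ltnP; rewrite ?mulr1 ?mulr0.
Qed.

(** Summing [a w <= (a ^ 2 / N + N w ^ 2) / 2], where [N] is the norm of [a],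
    bounds a linear form on the unit ball by the norm of its coefficients. *)
Lemma dot_le_norm {R : rcfType} {I : finType} (a w : I -> R) :
  \sum_i w i ^+ 2 <= 1 -> \sum_i a i * w i <= Num.sqrt (\sum_i a i ^+ 2).
Proof.
move=> w1; have a2_ge0 : 0 <= \sum_i a i ^+ 2.
  by apply: sumr_ge0 => i _; exact: sqr_ge0.
set N := Num.sqrt _; have N2 : N ^+ 2 = \sum_i a i ^+ 2 by rewrite sqr_sqrtr.
have N_ge0 : 0 <= N by exact: sqrtr_ge0.
have [N0|N_neq0] := eqVneq N 0.
  have a0 i : a i = 0.
    apply/eqP; rewrite -sqrf_eq0; move: N2; rewrite N0 expr0n /= => /esym/eqP.
    by rewrite psumr_eq0 => [/allP/(_ i (mem_index_enum i))|j _]//; exact: sqr_ge0.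
  by rewrite N0 big1 // => i _; rewrite a0 mul0r.
have N_gt0 : 0 < N by rewrite lt_neqAle eq_sym N_neq0.
have : 2 * N * (\sum_i a i * w i) <= \sum_i a i ^+ 2 + N ^+ 2 * \sum_i w i ^+ 2.
  rewrite !mulr_sumr -big_split /=; apply: ler_sum => i _.
  by have := sqr_ge0 (a i - N * w i); lra.
have := ler_wpM2l (sqr_ge0 N) w1.
by rewrite -N2 -[X in _ -> _ -> is_true X](ler_pM2l N_gt0); lra.
Qed.

Lemma beta_objectiveE {R : realType} {n m : nat} (sigma : 'I_n -> R) (Omega : R)
    (x : {ffun 'I_n -> bool}) (z : 'M[R]_(n, m)) :
  beta_objective sigma Omega x z =
  Omega * \sum_j (sigma j * (x j)%:R) * ((\sum_k z j k) / m%:R).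
Proof.
rewrite /beta_objective mulr_sumr; apply: eq_bigr => j _.
by rewrite /rkp_d -mulr_sumr; ring.
Qed.

Lemma beta_le_norm {R : realType} {n m : nat} (sigma : 'I_n -> R) (Omega : R)
    (x : {ffun 'I_n -> bool}) :
  (0 < m)%N -> 0 <= Omega ->
  beta sigma Omega m x (m ^ 2)%:R <=
  Omega * Num.sqrt (\sum_(j < n) sigma j ^+ 2 * (x j)%:R ^+ 2).
Proof.
move=> m_gt0 Omega_ge0.
have [z [z_budget z01] [-> _]] :=
  @beta_max R n m sigma Omega (m ^ 2)%:R x (ler0n _ _).
rewrite beta_objectiveE ler_wpM2l //.
under [in leRHS]eq_bigr do rewrite -exprMn.
apply: dot_le_norm.
under eq_bigr do rewrite expr_div_n.
rewrite -mulr_suml ler_pdivrMr ?exprn_gt0 ?ltr0n // mul1r -natrX.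
apply: le_trans z_budget; apply: ler_sum => j _.
exact: sqr_sum_le_weighted (z01 j).
Qed.

(** A point [w] of the unit ball is reached up to rounding: item [j] fills its
    cheapest [truncn (m * w j)] cells, at cost at most [(m * w j) ^ 2]. *)
Lemma exists_rounding {R : realType} {n : nat} (m : nat) (w : 'I_n -> R) :
  (forall j, 0 <= w j) -> \sum_j w j ^+ 2 <= 1 ->
  exists2 z : 'M[R]_(n, m), beta_feasible (m ^ 2)%:R z &
    forall j, m%:R * w j - 1 <= \sum_k z j k.
Proof.
move=> w_ge0 w1.
have w_le1 j : w j <= 1.
  rewrite -(@expr_le1 _ 2) //; apply: le_trans w1; rewrite (bigD1 j) //= lerDl.
  by apply: sumr_ge0 => i _; exact: sqr_ge0.
pose t j := Num.truncn (m%:R * w j).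
have mw_ge0 j : 0 <= m%:R * w j by rewrite mulr_ge0.
have t_le j : (t j)%:R <= m%:R * w j by rewrite truncn_le.
have t_le_m j : (t j <= m)%N.
  by rewrite -(ler_nat R) (le_trans (t_le j)) // ler_piMr.
exists (\matrix_(j, k) (k < t j)%:R) => [|j].
  split=> [|j k]; last by rewrite mxE ler0n lern1 leq_b1.
  rewrite natrX -[leRHS]mulr1.
  apply: (@le_trans _ _ (\sum_j (m%:R * w j) ^+ 2)); last first.
    by under eq_bigr do rewrite exprMn; rewrite -mulr_sumr ler_wpM2l ?sqr_ge0.
  apply: ler_sum => j _; under eq_bigr do rewrite mxE.
  rewrite (@sum_ord_prefix _ _ _ (fun k => 2 * k.+1%:R - 1)) // sum_odd.
  by rewrite lerXn2r ?nnegrE.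
under eq_bigr do rewrite mxE -[_%:R]mul1r.
rewrite (@sum_ord_prefix _ _ _ (fun=> 1)) // sumr_const card_ord lerBlDr natr1.
by apply/ltW; exact: truncnS_gt.
Qed.

Lemma norm_le_beta {R : realType} {n m : nat} (sigma : 'I_n -> R) (Omega : R)
    (x : {ffun 'I_n -> bool}) :
  (0 < m)%N -> 0 <= Omega -> (forall j, 0 <= sigma j) ->
  Omega * Num.sqrt (\sum_(j < n) sigma j ^+ 2 * (x j)%:R ^+ 2)
    <= beta sigma Omega m x (m ^ 2)%:R + Omega * (\sum_j sigma j) / m%:R.
Proof.
move=> m_gt0 Omega_ge0 sigma_ge0.
have [z0 _ [-> z0_max]] := @beta_max R n m sigma Omega (m ^ 2)%:R x (ler0n _ _).
pose a j := sigma j * (x j)%:R.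
have a_ge0 j : 0 <= a j by rewrite mulr_ge0.
under eq_bigr do rewrite -exprMn -/(a _).
set N := Num.sqrt _.
have N2 : N ^+ 2 = \sum_j a j ^+ 2.
  by rewrite sqr_sqrtr //; apply: sumr_ge0 => j _; exact: sqr_ge0.
(* If [N = 0], division by zero makes this direction the zero vector. *)
pose w j := a j / N.
have w_ge0 j : 0 <= w j by rewrite divr_ge0 ?sqrtr_ge0.
have w1 : \sum_j w j ^+ 2 <= 1.
  under eq_bigr do rewrite expr_div_n.
  rewrite -mulr_suml -N2; have [->|N_neq0] := eqVneq N 0.
    by rewrite expr0n mul0r.
  by rewrite divff // sqrf_eq0.
have aw : \sum_j a j * w j = N.
  under eq_bigr do rewrite mulrA -expr2.
  rewrite -mulr_suml -N2; have [->|N_neq0] := eqVneq N 0.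
    by rewrite expr0n mul0r.
  by rewrite expr2 mulfK.
have [z z_feas z_ge] := exists_rounding m w w_ge0 w1.
apply: le_trans (lerD (z0_max z z_feas) (lexx _)).
rewrite beta_objectiveE -mulrA -mulrDr ler_wpM2l // mulr_suml -big_split /= -aw.
apply: ler_sum => j _.
have mR_gt0 : 0 < m%:R :> R by rewrite ltr0n.
have w_le : w j <= (\sum_k z j k) / m%:R + m%:R^-1.
  rewrite -[X in _ + X]mul1r -mulrDl ler_pdivlMr //; have := z_ge j; lra.
apply: (le_trans (ler_wpM2l (a_ge0 j) w_le)).
rewrite mulrDr lerD2l ler_wpM2r ?invr_ge0 ?ler0n //.
by rewrite /a ler_piMr // lern1 leq_b1.
Qed.

Lemma sockp_rkp_feasible {R : realType} {n : nat} (ahat sigma : 'I_n -> R)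
    (b : nat) (Omega : R) (m : nat) (x : {ffun 'I_n -> bool}) :
  (0 < m)%N -> 0 <= Omega ->
  sockp_feasible ahat sigma b Omega x ->
  rkp_feasible ahat sigma b Omega m (m ^ 2)%:R x.
Proof.
move=> m_gt0 Omega_ge0; apply: le_trans.
by rewrite lerD2l beta_le_norm.
Qed.

(** Every vector outside the feasible set of (SOCKP) exceeds the capacity by a
    positive amount; [m0] exceeds the quotient of [Omega * \sum_j sigma j] by
    each of these finitely many amounts. *)
Lemma eventually_rkp_sockp_feasible {R : realType} {n : nat}
    (ahat sigma : 'I_n -> R) (b : nat) (Omega : R) :
  0 <= Omega -> (forall j, 0 <= sigma j) ->
  exists m0 : nat, (0 < m0)%N /\
    forall m, (m0 <= m)%N -> forall x : {ffun 'I_n -> bool},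
      rkp_feasible ahat sigma b Omega m (m ^ 2)%:R x ->
      sockp_feasible ahat sigma b Omega x.
Proof.
move=> Omega_ge0 sigma_ge0.
pose C := Omega * \sum_j sigma j.
pose excess (x : {ffun 'I_n -> bool}) := \sum_(j < n) ahat j * (x j)%:R
  + Omega * Num.sqrt (\sum_(j < n) sigma j ^+ 2 * (x j)%:R ^+ 2) - b%:R.
exists (\max_x Num.truncn (C / excess x)).+1; split=> // m m0_le x rkp_x.
have m_gt0 : (0 < m)%N by exact: leq_trans m0_le.
have mR_gt0 : 0 < m%:R :> R by rewrite ltr0n.
rewrite /sockp_feasible -subr_le0 -/(excess x) leNgt; apply/negP => excess_gt0.
have : C / excess x < m%:R.
  apply: lt_le_trans (truncnS_gt _) _; rewrite ler_nat.
  by apply: leq_trans m0_le; rewrite ltnS; exact: (leq_bigmax x).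
rewrite ltr_pdivrMr // mulrC -ltr_pdivrMr // => C_lt.
have := norm_le_beta sigma Omega x m_gt0 Omega_ge0 sigma_ge0; rewrite -/C.
move: rkp_x C_lt; rewrite /rkp_feasible /excess; lra.
Qed.

Theorem proposition5 (R : realType) (n : nat) (p : 'I_n -> nat)
    (ahat sigma : 'I_n -> R) (b : nat) (Omega : R)
    (ahat_ge0 : forall j, 0 <= ahat j) (sigma_ge0 : forall j, 0 <= sigma j)
    (Omega_gt0 : 0 < Omega) :
  exists m0 : nat, (0 < m0)%N /\
    forall m : nat, (m0 <= m)%N ->
    forall x : {ffun 'I_n -> bool},
      optimal_solution p (rkp_feasible ahat sigma b Omega m (m ^ 2)%:R) x ->
      optimal_solution p (sockp_feasible ahat sigma b Omega) x.
Proof.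
have Omega_ge0 := ltW Omega_gt0.
have [m0 [m0_gt0 rkp_sockp]] :=
  eventually_rkp_sockp_feasible ahat sigma b Omega Omega_ge0 sigma_ge0.
exists m0; split=> // m m0_le x [x_feas x_max].
split=> [|y y_feas]; first exact: rkp_sockp x_feas.
by apply: x_max; apply: sockp_rkp_feasible y_feas => //; exact: leq_trans m0_le.
Qed.
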